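(* Let $\varphi$ be a formula of $\mathrm{SL}( *,\mathrm{reach}^+)$ built over the variables $x_1,\dots,x_q$. Then $\varphi$ is logically equivalent (satisfied by exactly the same memory states) to a Boolean combination of test formulas from $\mathrm{Test}(q,\mathrm{msize}(\varphi))$.
   Context: A memory state is $(s,h)$ with $s:\mathrm{PVAR}\to\mathrm{LOC}$ (program variables $x_1,x_2,\dots$) and $h$ a partial function $\mathrm{LOC}\to\mathrm{LOC}$ with finite domain. $h^0=\mathrm{id}$, $h^{n+1}(l)=h(h^n(l))$ when defined. $\mathrm{SL}( *,\mathrm{reach}^+)$ has atoms $x=y$, $x\hookrightarrow y$, $\mathrm{emp}$, $\mathrm{reach}^+(x,y)$ and connectives $\neg,\wedge,*$: $(s,h)\models x=y$ iff $s(x)=s(y)$; $\mathrm{emp}$ iff $\mathrm{dom}(h)=\emptyset$; $x\hookrightarrow y$ iff $s(x)\in\mathrm{dom}(h)$, $h(s(x))=s(y)$; $\mathrm{reach}^+(x,y)$ iff $h^i(s(x))=s(y)$ for some $i\ge1$; $\varphi_1*\varphi_2$ iff $h=h_1+h_2$ with disjoint domains, $(s,h_1)\models\varphi_1$, $(s,h_2)\models\varphi_2$. Memory size: $\mathrm{msize}$ of an atom is $1$, $\mathrm{msize}(\neg\psi)=\mathrm{msize}(\psi)$, $\mathrm{msize}(\psi\wedge\psi')=\max(\mathrm{msize}(\psi),\mathrm{msize}(\psi'))$, $\mathrm{msize}(\psi*\psi')=\mathrm{msize}(\psi)+\mathrm{msize}(\psi')$. Terms: $\mathrm{Terms}_q=\{x_1,\dots,x_q\}\cup\{m_q(x_i,x_j)\mid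 i,j\le q\}$. $[\![x_i]\!]^q_{s,h}=s(x_i)$; $[\![m_q(x_i,x_j)]\!]^q_{s,h}$ is the unique location $l$ (undefined if none) such that there are $L_1,L_2\ge0$ with $h^{L_1}(s(x_i))=h^{L_2}(s(x_j))=l$, for all $L_1'<L_1$ and $L_2'\ge0$, $h^{L_1'}(s(x_i))\neq h^{L_2'}(s(x_j))$, and there are $k\le q$, $L\ge0$ with $h^L(l)=s(x_k)$. $\mathrm{Labels}_q(s,h)$ is the set of defined values $[\![t]\!]^q_{s,h}$. Support graph of $(s,h)$: $V=\mathrm{Labels}_q(s,h)$; $(l,l')\in E$ iff $l,l'\in V$, there is $L\ge1$ with $h^L(l)=l'$ and $h^{L'}(l)\notin V$ for $0<L'<L$; $A=V\cap\mathrm{dom}(h)$; $\mathrm{Lab}(l)=\{t\mid[\![t]\!]^q_{s,h}=l\}$; for $(l,l')\in E$, $\mathrm{Btw}(l,l')$ is the set of $l''$ with $L,L'\ge1$, $h^L(l)=l''$, $h^{L'}(l'')=l'$ and $h^{L''}(l)\notin V$ for all $L''\in[1,L]$; $\mathrm{Rem}=\mathrm{dom}(h)\setminus(A\cup\bigcup_{(l,l')\in E}\mathrm{Btw}(l,l'))$. $\mathrm{Test}(q,\alpha)$: formulas $t=t'$, $\mathrm{alloc}(t)$, $t\hookrightarrow t'$, $\mathrm{sees}_q(t,t')\ge\beta+1$, $\mathrm{sizeR}_q\ge\beta$ ($t,t'\in\mathrm{Terms}_q$, $\beta\in\{1,\dots,\alpha\}$) with semantics: $t=t'$ iff some $l\in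 V$ has $\{t,t'\}\subseteq\mathrm{Lab}(l)$; $\mathrm{alloc}(t)$ iff some $l\in A$ has $t\in\mathrm{Lab}(l)$; $t\hookrightarrow t'$ iff some $(l,l')\in E$ has $t\in\mathrm{Lab}(l)$, $t'\in\mathrm{Lab}(l')$, $\mathrm{Btw}(l,l')=\emptyset$; $\mathrm{sees}_q(t,t')\ge\beta+1$ iff some $(l,l')\in E$ has $t\in\mathrm{Lab}(l)$, $t'\in\mathrm{Lab}(l')$, $|\mathrm{Btw}(l,l')|\ge\beta$; $\mathrm{sizeR}_q\ge\beta$ iff $|\mathrm{Rem}|\ge\beta$. *)

(* Defs.v *)
From mathcomp Require Import all_boot finmap.
From mathcomp Require Import all_classical.

Set Implicit Arguments.
Unset Strict Implicit.
Unset Printing Implicit Defensive.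

Local Open Scope fset_scope.
Local Open Scope fmap_scope.
Local Open Scope classical_set_scope.
Local Open Scope card_scope.

(* The index [i : PVAR] stands for the program variable x_{i+1}, so that
   x_1, ..., x_q are the indices below q. *)
Definition PVAR := nat.

Definition store (LOC : choiceType) := PVAR -> LOC.
Definition heap (LOC : choiceType) := {fmap LOC -> LOC}.

(* [hiter h n l = None] means that h^n(l) is undefined. *)
Definition hiter (LOC : choiceType) (h : heap LOC) (n : nat) (l : LOC) :
  option LOC := iter n (obind (fun l' => h.[? l'])) (Some l).

Inductive sl :=
| SLEq of PVAR & PVAR
| SLPointsTo of PVAR & PVAR
| SLEmp
| SLReachPlus of PVAR & PVAR
| SLNeg of sl
| SLAnd of sl & sl
| SLStar of sl & sl.

Fixpoint sl_over (q : nat) (phi : sl) : bool :=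
  match phi with
  | SLEq x y | SLPointsTo x y | SLReachPlus x y => (x < q) && (y < q)
  | SLEmp => true
  | SLNeg psi => sl_over q psi
  | SLAnd psi psi' | SLStar psi psi' => sl_over q psi && sl_over q psi'
  end.

Fixpoint msize (phi : sl) : nat :=
  match phi with
  | SLEq _ _ | SLPointsTo _ _ | SLEmp | SLReachPlus _ _ => 1
  | SLNeg psi => msize psi
  | SLAnd psi psi' => maxn (msize psi) (msize psi')
  | SLStar psi psi' => msize psi + msize psi'
  end.

Fixpoint sl_sat (LOC : choiceType) (s : store LOC) (h : heap LOC) (phi : sl) :
  Prop :=
  match phi with
  | SLEq x y => s x = s y
  | SLPointsTo x y => h.[? s x] = Some (s y)
  | SLEmp => domf h = fset0
  | SLReachPlus x y => exists2 i, 1 <= i & hiter h i (s x) = Some (s y)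
  | SLNeg psi => ~ sl_sat s h psi
  | SLAnd psi psi' => sl_sat s h psi /\ sl_sat s h psi'
  | SLStar psi psi' => exists h1 h2 : heap LOC,
      [/\ fdisjoint (domf h1) (domf h2), h = h1 + h2,
          sl_sat s h1 psi & sl_sat s h2 psi']
  end.

Inductive term (q : nat) :=
| TVar of 'I_q
| TMeet of 'I_q & 'I_q.

Section SupportGraph.
Variables (LOC : choiceType) (q : nat) (s : store LOC) (h : heap LOC).

(* For L1' < L1 the left-hand side of the disequality is defined, so the
   disequality also holds when h^{L2'}(s(x_j)) is undefined. *)
Definition is_meet (i j : 'I_q) (l : LOC) : Prop :=
  (exists L1 L2 : nat,
    [/\ hiter h L1 (s i) = Some l, hiter h L2 (s j) = Some l
      & forall L1' L2' : nat, L1' < L1 ->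
          hiter h L1' (s i) <> hiter h L2' (s j)])
  /\ exists (k : 'I_q) (L : nat), hiter h L l = Some (s k).

(* The graph of the partial interpretation function; see [denotes_functional]. *)
Definition denotes (t : term q) (l : LOC) : Prop :=
  match t with
  | TVar i => s i = l
  | TMeet i j => is_meet i j l
  end.

Lemma denotes_functional (t : term q) (l l' : LOC) :
  denotes t l -> denotes t l' -> l = l'.
Proof.
case: t => [i|i j] /=; first by move=> <-.
move=> [[L1 [L2 [e1 e2 min]]] _] [[M1 [M2 [f1 f2 min']]] _].
have [lt|lt|eq] := ltngtP L1 M1.
- by case: (min' L1 L2 lt); rewrite e1 e2.
- by case: (min M1 M2 lt); rewrite f1 f2.
- by move: f1; rewrite -eq e1 => -[].
Qed.

Definition Labels : set LOC := [set l | exists t, denotes t l].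

Definition Lab (l : LOC) : set (term q) := [set t | denotes t l].

Definition Edge : set (LOC * LOC) :=
  [set e | [/\ Labels e.1, Labels e.2
    & exists L : nat, [/\ 1 <= L, hiter h L e.1 = Some e.2
      & forall L' v, 0 < L' < L -> hiter h L' e.1 = Some v -> ~ Labels v]]].

Definition Alloc : set LOC := Labels `&` [set` domf h].

Definition Btw (l l' : LOC) : set LOC :=
  [set l'' | exists L L' : nat,
    [/\ 1 <= L, 1 <= L', hiter h L l = Some l'', hiter h L' l'' = Some l'
      & forall L'' v, 1 <= L'' <= L -> hiter h L'' l = Some v -> ~ Labels v]].

Definition Rem : set LOC :=
  [set` domf h] `\` (Alloc `|` \bigcup_(e in Edge) Btw e.1 e.2).

End SupportGraph.

(* [TestSees t t' b] is the formula sees_q(t,t') >= b+1 and [TestSizeR q b] is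
   the formula sizeR_q >= b. *)
Inductive test (q : nat) :=
| TestEq of term q & term q
| TestAlloc of term q
| TestPointsTo of term q & term q
| TestSees of term q & term q & nat
| TestSizeR of nat.

Definition Test (q alpha : nat) : pred (test q) := fun tau =>
  match tau with
  | TestSees _ _ b | TestSizeR b => 1 <= b <= alpha
  | _ => true
  end.

(* |X| >= b is expressed as `I_b #<= X, where `I_b is the set of naturals
   below b. *)
Definition test_sat (LOC : choiceType) (q : nat) (s : store LOC)
  (h : heap LOC) (tau : test q) : Prop :=
  match tau with
  | TestEq t t' => exists l, [/\ Labels q s h l, Lab s h l t & Lab s h l t']
  | TestAlloc t => exists l, Alloc q s h l /\ Lab s h l t
  | TestPointsTo t t' => exists l l',
      [/\ Edge q s h (l, l'), Lab s h l t, Lab s h l' t'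
        & Btw q s h l l' = set0]
  | TestSees t t' b => exists l l',
      [/\ Edge q s h (l, l'), Lab s h l t, Lab s h l' t'
        & `I_b #<= Btw q s h l l']
  | TestSizeR b => `I_b #<= Rem q s h
  end.

Inductive boolcomb (T : Type) :=
| BCAtom of T
| BCNeg of boolcomb T
| BCAnd of boolcomb T & boolcomb T.

Fixpoint bc_over (T : Type) (P : pred T) (psi : boolcomb T) : bool :=
  match psi with
  | BCAtom tau => P tau
  | BCNeg psi1 => bc_over P psi1
  | BCAnd psi1 psi2 => bc_over P psi1 && bc_over P psi2
  end.

Fixpoint bc_sat (T : Type) (sat : T -> Prop) (psi : boolcomb T) : Prop :=
  match psi with
  | BCAtom tau => sat tau
  | BCNeg psi1 => ~ bc_sat sat psi1
  | BCAnd psi1 psi2 => bc_sat sat psi1 /\ bc_sat sat psi2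
  end.

(* Main.v *)
Require Import Defs.
From mathcomp Require Import all_boot finmap.
From mathcomp Require Import all_classical.
From mathcomp Require Import zify.

Set Implicit Arguments.
Unset Strict Implicit.
Unset Printing Implicit Defensive.

Local Open Scope fset_scope.
Local Open Scope classical_set_scope.
Local Open Scope card_scope.
Local Open Scope nat_scope.

(* There are finitely many tests, so it suffices that satisfaction of [phi] is
   invariant under agreement on [Test q (msize phi)].  Let (s,h) and (s',h') agree
   on these tests.  The support graph cuts dom(h) into cells: one per allocated
   label, one per segment between consecutive labels, and [Rem]; segments issued
   from different labels are disjoint because paths can only merge at a label.
   The cells of h and h' correspond to each other.  The invariance is proved for
   the restrictions of h and h' to domains D and D' such that every cell meets D and
   D' in the same number of points up to [msize phi], and is included in D iff the
   corresponding cell is included in D'.  A decomposition of D is then copied to D'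
   cell by cell, whatever the separating conjunctions; labels are never recomputed
   for a subheap.  On the atoms, a path between variables in a subheap is a chain
   of labels and segments included in its domain. *)

(** * Boolean combinations from invariance under finitely many tests *)

Section BooleanCombinations.
Variables (T M : Type) (P : pred T) (sat : M -> T -> Prop).

Definition agree_on (X : T -> Prop) (m m' : M) : Prop :=
  forall x, X x -> sat m x <-> sat m' x.

(** Induction on [r] splits [S] by the truth value of the head test; [t0] serves to write the
    constants true and false. *)
Lemma bc_of_invariant (t0 : T) (r : seq T) (S : M -> Prop) :
  P t0 -> all P r ->
  (forall m m', agree_on (fun x => List.In x r) m m' -> S m -> S m') ->
  exists psi, bc_over P psi /\ forall m, S m <-> bc_sat (sat m) psi.
Proof.
move=> Pt0; elim: r S => [|t r IH] S.
  move=> _ Sinv; have [[m Sm]|nS] := pselect (exists m, S m).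
    (* With no test left, all states agree, so [S] holds everywhere or nowhere. *)
    exists (BCNeg (BCAnd (BCAtom t0) (BCNeg (BCAtom t0)))).
    split=> [|m']; first by rewrite /= Pt0.
    by split=> [_ []|_] //=; apply: Sinv Sm.
  exists (BCAnd (BCAtom t0) (BCNeg (BCAtom t0))).
  split=> [|m]; first by rewrite /= Pt0.
  by split=> [Sm|[]//]; case: nS; exists m.
move=> /= /andP[Pt Pr] Sinv.
(* The states of [S] giving [t] the value [b], closed under agreement on [r], so that the induction
   hypothesis applies. If a state of [S_ b] itself gives [t] the value [b], it agrees with a state
   of [S] on all of [t :: r], so it lies in [S]. *)
pose S_ (b : Prop) m :=
  exists m0, [/\ S m0, sat m0 t <-> b & agree_on (fun x => List.In x r) m0 m].
have S_inv b m m' : agree_on (fun x => List.In x r) m m' -> S_ b m -> S_ b m'.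
  move=> mm' [m0 [Sm0 m0t m0m]]; exists m0; split=> // x rx.
  by rewrite (m0m x rx); apply: mm'.
have [psi1 [P1 sat1]] := IH _ Pr (@S_inv True).
have [psi2 [P2 sat2]] := IH _ Pr (@S_inv False).
exists (BCNeg (BCAnd (BCNeg (BCAnd (BCAtom t) psi1))
                     (BCNeg (BCAnd (BCNeg (BCAtom t)) psi2)))).
split=> [|m]; first by rewrite /= Pt P1 P2.
rewrite /= -sat1 -sat2; split.
  move=> Sm [n1 n2]; have [mt|nmt] := pselect (sat m t).
    by apply: n1; split=> //; exists m.
  by apply: n2; split=> //; exists m.
move=> n; apply: contrapT => nSm; apply: n.
by split=> -[mt [m0 [Sm0 m0t m0m]]]; apply: nSm; apply: Sinv Sm0 => x [<-|/m0m//];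
  split; tauto.
Qed.

End BooleanCombinations.

(** * Enumeration of the tests *)

Section FiniteTests.
Variable q : nat.

Definition all_terms : seq (term q) :=
  [seq TVar i | i <- enum 'I_q]
  ++ [seq TMeet i j | i <- enum 'I_q, j <- enum 'I_q].

Lemma In_map_enum (I : finType) (U : Type) (f : I -> U) i :
  List.In (f i) [seq f j | j <- enum I].
Proof.
have: i \in enum I by rewrite mem_enum.
elim: (enum I) => // j r IH; rewrite inE => /orP[/eqP->|/IH]; first by left.
by right.
Qed.

Lemma In_cat (U : Type) (x : U) r1 r2 :
  List.In x (r1 ++ r2) <-> List.In x r1 \/ List.In x r2.
Proof. exact: List.in_app_iff. Qed.

Lemma In_allpairs (U V W : Type) (f : U -> V -> W) x y rx ry :
  List.In x rx -> List.In y ry -> List.In (f x y) [seq f x y | x <- rx, y <- ry].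
Proof.
move=> + ry_y; elim: rx => //= z rx IH [->|/IH]; rewrite In_cat; last by right.
by left; apply: List.in_map.
Qed.

Lemma In_all_terms t : List.In t all_terms.
Proof.
apply/In_cat; case: t => [i|i j]; [left|right]; first exact: In_map_enum.
by apply: In_allpairs; rewrite -[enum _]map_id; apply: (@In_map_enum _ _ id).
Qed.

Definition all_tests (alpha : nat) : seq (test q) :=
  [seq TestEq t u | t <- all_terms, u <- all_terms]
  ++ [seq TestAlloc t | t <- all_terms]
  ++ [seq TestPointsTo t u | t <- all_terms, u <- all_terms]
  ++ [seq TestSees tu.1 tu.2 b
     | tu <- [seq (t, u) | t <- all_terms, u <- all_terms], b <- iota 1 alpha]
  ++ [seq TestSizeR q b | b <- iota 1 alpha].

Lemma all_allpairs (U V W : Type) (p : pred W) (f : U -> V -> W) rx ry :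
  (forall x, all (fun y => p (f x y)) ry) ->
  all p [seq f x y | x <- rx, y <- ry].
Proof. by move=> pf; elim: rx => //= x rx IH; rewrite all_cat all_map pf. Qed.

Lemma all_tests_over alpha : all (@Test q alpha) (all_tests alpha).
Proof.
have sub b : b \in iota 1 alpha -> 1 <= b <= alpha by rewrite mem_iota.
rewrite /all_tests !all_cat; apply/and5P; split.
- by apply: all_allpairs => t; elim: all_terms.
- by rewrite all_map; elim: all_terms.
- by apply: all_allpairs => t; elim: all_terms.
- by apply: all_allpairs => tu; apply/allP.
- by rewrite all_map; apply/allP.
Qed.

Lemma In_all_tests alpha tau :
  Test alpha tau -> List.In tau (all_tests alpha).
Proof.
have In_iota b : 1 <= b <= alpha -> List.In b (iota 1 alpha).
  move=> b1a; have: b \in iota 1 alpha by rewrite mem_iota; lia.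
  by elim: (iota 1 alpha) => // j r IH; rewrite inE => /orP[/eqP->|/IH]; [left|right].
rewrite /all_tests !In_cat; case: tau => [t u|t|t u|t u b|b] /= Ttau.
- by left; apply: In_allpairs; apply: In_all_terms.
- by right; left; apply: List.in_map; apply: In_all_terms.
- by do 2!right; left; apply: In_allpairs; apply: In_all_terms.
- do 3!right; left; apply: (@In_allpairs _ _ _ (fun tu b => TestSees tu.1 tu.2 b) (t, u));
    last exact: In_iota.
  by apply: (@In_allpairs _ _ _ pair); apply: In_all_terms.
- by do 4!right; apply: List.in_map; apply: In_iota.
Qed.

End FiniteTests.

(** * Iteration, loops and restriction of heaps *)

Section Heaps.
Variable LOC : choiceType.
Implicit Types (h : heap LOC) (l a b : LOC) (D : {fset LOC}).

Lemma hiterS h n l :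
  hiter h n.+1 l = obind (fun l' => h.[? l'])%fmap (hiter h n l).
Proof. by []. Qed.

Lemma hiter_add h n m l p :
  hiter h n l = Some p -> hiter h (n + m) l = hiter h m p.
Proof. by move=> e; rewrite /hiter addnC iterD -/(hiter h n l) e. Qed.

Lemma hiter_split h n m l p : hiter h (n + m) l = Some p ->
  exists2 r, hiter h n l = Some r & hiter h m r = Some p.
Proof.
case e: (hiter h n l) => [r|]; first by rewrite (hiter_add _ e); exists r.
rewrite /hiter addnC iterD -/(hiter h n l) e.
suff -> : iter m (obind (fun l' => h.[? l'])%fmap) None = None by [].
by elim: m => // m IH; rewrite iterS IH.
Qed.

Lemma hiter_le h n m l p : n <= m -> hiter h m l = Some p ->
  exists2 r, hiter h n l = Some r & hiter h (m - n) r = Some p.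
Proof. by move=> /subnKC {1}<-; apply: hiter_split. Qed.

Lemma hiter_mul_loop h n p l :
  hiter h p l = Some l -> hiter h (n * p) l = Some l.
Proof. by move=> e; elim: n => // n IH; rewrite mulSn (hiter_add _ e). Qed.

Lemma hiter_gt0_dom h n l p : 0 < n -> hiter h n l = Some p -> l \in domf h.
Proof.
case: n => // n _ /(@hiter_split h 1 n)[r]; rewrite /hiter /= => e _.
by rewrite -fndSome e.
Qed.

(** A step needs only its source in [D]; the endpoint [p] may lie outside. *)
Lemma hiter_restrict h D n l p : hiter (h.[& D])%fmap n l = Some p <->
  hiter h n l = Some p /\
  forall m r, m < n -> hiter h m l = Some r -> r \in D.
Proof.
elim: n p => [|n IH] p; first by split=> [|[]].
rewrite !hiterS; split.
  case e: (hiter _ n l) => [r|] //=; have [-> /= rD] := (IH r).1 e.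
  rewrite fnd_restrict; case: ifP => // rinD hr; split=> // m r'.
  rewrite ltnS leq_eqVlt => /orP[/eqP->|/rD]; last by apply.
  by have [-> _] := (IH r).1 e; case=> <-.
case; case e: (hiter h n l) => [r|] //= hr inD.
have -> /= : hiter (h.[& D])%fmap n l = Some r.
  by apply/IH; split=> // m r' mn; apply: inD; rewrite ltnS ltnW.
by rewrite fnd_restrict (inD n r).
Qed.

Definition reach h a b : Prop := exists n, hiter h n a = Some b.

Lemma reach_trans h b a c : reach h a b -> reach h b c -> reach h a c.
Proof. by case=> n e [m f]; exists (n + m); rewrite (hiter_add _ e). Qed.

Lemma reach_total h x a b :
  reach h x a -> reach h x b -> reach h a b \/ reach h b a.
Proof.
move=> [n e] [m f]; case: (leqP n m) => [nm|/ltnW mn].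
  by have [r] := hiter_le nm f; rewrite e => -[<-] ?; left; exists (m - n).
by have [r] := hiter_le mn e; rewrite f => -[<-] ?; right; exists (n - m).
Qed.

(* Both are the [(n1 + 1)(n2 + 1) - 1]-th iterate of [e]. *)
Lemma loop_pred_inj h e u1 u2 :
  (h.[? u1])%fmap = Some e -> (h.[? u2])%fmap = Some e ->
  reach h e u1 -> reach h e u2 -> u1 = u2.
Proof.
move=> h1 h2 [n1 e1] [n2 e2].
have l1 : hiter h n1.+1 e = Some e by rewrite hiterS e1.
have l2 : hiter h n2.+1 e = Some e by rewrite hiterS e2.
have := hiter_add n1 (hiter_mul_loop n2 l1); rewrite e1.
have := hiter_add n2 (hiter_mul_loop n1 l2); rewrite e2.
by rewrite (_ : n1 * n2.+1 + n2 = n2 * n1.+1 + n1) => [->[]|]; last lia.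
Qed.

(** The loop through [e] has length [p + 1]. Going round it [m] times takes [m + m * p] steps, and
    the first [m] lead to [x]. *)
Lemma loop_reach_back h e u x :
  (h.[? u])%fmap = Some e -> reach h e u -> reach h e x -> reach h x e.
Proof.
move=> hu [p ep] [m em].
have loop : hiter h p.+1 e = Some e by rewrite hiterS ep.
have := hiter_mul_loop m loop.
by rewrite mulnS (hiter_add _ em); exists (m * p).
Qed.

Lemma domf_restrict_sub h D : (D `<=` domf h)%fset -> domf (h.[& D])%fmap = D.
Proof. by move=> sub; rewrite domf_restrict; apply/fsetIidPl. Qed.

(** This turns the heap decomposition of [SLStar] into a decomposition of the set [D] of
    locations. *)
Lemma catf_restrict h1 h2 h D : fdisjoint (domf h1) (domf h2) ->
  (h.[& D])%fmap = (h1 + h2)%fset ->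
  h1 = (h.[& domf h1])%fmap /\ h2 = (h.[& domf h2])%fmap.
Proof.
move=> dis e.
have fnd12 k : ((h1 + h2)%fset.[? k])%fmap = if k \in D then (h.[? k])%fmap else None.
  by rewrite -e fnd_restrict.
split; apply/fmapP=> k; have := fnd12 k; rewrite fnd_restrict fnd_cat.
  case: (boolP (k \in domf h1)) => k1; last by rewrite [(h1.[? k])%fmap]not_fnd.
  have k2 := fdisjointP dis k k1.
  by rewrite /= (negPf k2) /=; case: ifP => // _; rewrite in_fnd.
case: (boolP (k \in domf h2)) => k2; last by rewrite [(h2.[? k])%fmap]not_fnd.
by move=> /=; case: ifP => // _; rewrite in_fnd.
Qed.

Lemma restrict_catf h D1 D2 :
  (h.[& (D1 `|` D2)%fset])%fmap = (h.[& D1]%fmap + h.[& D2]%fmap)%fset.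
Proof.
apply/fmapP=> k; rewrite fnd_cat !fnd_restrict domf_restrict !inE.
case: (boolP (k \in D2)) => k2; rewrite ?orbT ?orbF //=.
case: ifP => // /negbT kh; rewrite not_fnd //.
by case: ifP.
Qed.

End Heaps.

(** * Merging paths, segments and cells of the support graph *)

Section SupportGraphFacts.
Variables (LOC : choiceType) (q : nat) (s : store LOC) (h : heap LOC).
Implicit Types (l a b u e : LOC) (t : term q) (i j k : 'I_q).

Let reaches_var l := exists k : 'I_q, reach h l (s k).

Lemma Labels_var i : Labels q s h (s i).
Proof. by exists (TVar i). Qed.

Lemma Labels_from_var l : Labels q s h l -> exists i : 'I_q, reach h (s i) l.
Proof.
by case=> -[i <-|i j [[n [_ [e _ _]]] _]]; exists i; [exists 0|exists n].
Qed.

Lemma Labels_to_var l : Labels q s h l -> reaches_var l.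
Proof.
by case=> -[i <-|i j [_ [k [n e]]]]; [exists i; exists 0|exists k; exists n].
Qed.

(** A term denotes at most one location. Hence [Lab l] names the label [l] by a set of terms, which
    can be compared across memory states. *)
Lemma Lab_inj l l' : Labels q s h l -> @Lab _ q s h l = @Lab _ q s h l' -> l = l'.
Proof.
move=> [t tl] ell'; have : Lab s h l' t by rewrite -ell'.
exact: denotes_functional tl.
Qed.

(** Here [e] is the meet of [i] and [j]: a common point met by [s i] before [e] would let [s j]
    reach [u]. *)
Lemma meet_at_entry i j u e :
  reach h (s i) u -> (h.[? u])%fmap = Some e -> reach h (s j) e ->
  ~ reach h (s j) u -> reaches_var e -> Labels q s h e.
Proof.
move=> [n iu] ue [m je] nju [k [p ek]]; exists (TMeet i j); split; last by exists k, p.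
exists n.+1, m; split=> // [|n' m']; first by rewrite hiterS iu.
rewrite ltnS => n'n ij; apply: nju; have [r ir ru] := hiter_le n'n iu.
by apply: (@reach_trans _ _ r); [exists m'; rewrite -ij|exists (n - n')].
Qed.

(* If [e] were not a label, every variable reaching [e] would reach both
   predecessors; then [e] lies on a cycle, and so does the variable reached from
   [e], hence both predecessors are on that cycle. *)
Lemma label_of_merge u1 u2 e i1 i2 :
  u1 <> u2 -> (h.[? u1])%fmap = Some e -> (h.[? u2])%fmap = Some e ->
  reach h (s i1) u1 -> reach h (s i2) u2 -> reaches_var e -> Labels q s h e.
Proof.
move=> u12 h1 h2 r1 r2 ev; apply: contrapT => nLe.
have step u : (h.[? u])%fmap = Some e -> reach h u e by exists 1.
have to1 (j : 'I_q) : reach h (s j) e -> reach h (s j) u1.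
  by move=> je; apply: contrapT => nju; apply: nLe; apply: meet_at_entry r1 h1 je nju ev.
have to2 (j : 'I_q) : reach h (s j) e -> reach h (s j) u2.
  by move=> je; apply: contrapT => nju; apply: nLe; apply: meet_at_entry r2 h2 je nju ev.
have r12 := to2 _ (reach_trans r1 (step _ h1)).
have past u v : (h.[? u])%fmap = Some e -> u <> v -> reach h u v -> reach h e v.
  move=> hu uv [[|n]]; first by case.
  by move=> /(@hiter_split _ h 1 n)[r]; rewrite /hiter /= hu => -[<-]; exists n.
have [k ek] := ev.
have ke : reach h (s k) e.
  case: (reach_total r1 r12) => [|r21].
    by move=> /(past _ _ h1 u12) eu2; apply: loop_reach_back h2 eu2 ek.
  by apply: loop_reach_back h1 _ ek; apply: past h2 _ r21 => /esym.
by apply: u12; apply: (loop_pred_inj h1 h2); apply: reach_trans ek _; auto.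
Qed.

(** Both paths are followed backwards from [l]. Distinct predecessors would make their common
    successor a label, by [label_of_merge]. If one path reaches its source first, this source is a
    label inside the other label-free path. *)
Lemma label_free_source a a' l n m :
  Labels q s h a -> Labels q s h a' ->
  hiter h n.+1 a = Some l -> hiter h m.+1 a' = Some l ->
  (forall n' v, 1 <= n' <= n.+1 -> hiter h n' a = Some v -> ~ Labels q s h v) ->
  (forall n' v, 1 <= n' <= m.+1 -> hiter h n' a' = Some v -> ~ Labels q s h v) ->
  reaches_var l -> a = a'.
Proof.
elim: n m l => [|n IH] m l La La' al a'l af a'f lv.
  have [r] := hiter_le (leqnSn 0) al; rewrite /hiter => -[<-] {r} _.
  have ha : (h.[? a])%fmap = Some l by [].
  case: m a'l a'f => [|m] a'l a'f.
    apply: contrapT => aa'; apply: (af 1 l _ al) => //.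
    have [[i ia] [j ja']] := (Labels_from_var La, Labels_from_var La').
    exact: label_of_merge aa' ha a'l ia ja' lv.
  have [u a'u ul] := hiter_le (leqnSn m.+1) a'l.
  rewrite subSnn in ul.
  have [au|au] := pselect (a = u).
    by case: (a'f m.+1 u _ a'u); rewrite ?ltnS ?leqnSn // -au.
  case: (af 1 l _ al) => //.
  have [[i ia] [j ja']] := (Labels_from_var La, Labels_from_var La').
  by apply: label_of_merge au ha ul ia (reach_trans ja' _) lv; exists m.+1.
have [u au ul] := hiter_le (leqnSn n.+1) al; rewrite subSnn in ul.
have [u' a'u' u'l] := hiter_le (leqnSn m) a'l; rewrite subSnn in u'l.
have [[i ia] [j ja']] := (Labels_from_var La, Labels_from_var La').
have [uu'|uu'] := pselect (u = u'); last first.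
  case: (af n.+2 l _ al); first by rewrite leqnn.
  by apply: label_of_merge uu' ul u'l (reach_trans ia _) (reach_trans ja' _) lv;
    [exists n.+1|exists m].
case: m a'l a'f a'u' => [|m] a'l a'f a'u'.
  case: a'u' => a'u'; case: (af n.+1 u _ au); first by rewrite leqnSn.
  by rewrite uu' -a'u'.
apply: (IH m u) => // [|n' v n'n|n' v n'n|].
- by rewrite uu'.
- by apply: af; lia.
- by apply: a'f; lia.
- by have [k lk] := lv; exists k; apply: reach_trans lk; exists 1.
Qed.

Lemma Btw_source a b a' b' l :
  Edge q s h (a, b) -> Edge q s h (a', b') ->
  Btw q s h a b l -> Btw q s h a' b' l -> a = a'.
Proof.
move=> [/= La Lb _] [/= La' _ _] [[|n] [m [// _ m0 al lb af]]].
move=> [[|n'] [m' [// _ _ a'l _ a'f]]].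
apply: label_free_source al a'l af a'f _ => //.
have [k bk] := Labels_to_var Lb.
by exists k; apply: reach_trans bk; exists m.
Qed.

Lemma Edge_target a b b' :
  Edge q s h (a, b) -> Edge q s h (a, b') -> b = b'.
Proof.
move=> [/= _ Lb [n [n0 ab af]]] [/= _ Lb' [n' [n'0 ab' af']]].
have [lt|lt|eq] := ltngtP n n'.
- by case: (af' n b _ ab); rewrite ?n0.
- by case: (af n' b' _ ab'); rewrite ?n'0.
- by move: ab'; rewrite -eq ab => -[].
Qed.

Lemma Btw_not_Labels a b l : Btw q s h a b l -> ~ Labels q s h l.
Proof. by case=> n [m [n0 _ al _ af]]; apply: af al; rewrite n0 leqnn. Qed.

Lemma Btw_dom a b l : Btw q s h a b l -> l \in domf h.
Proof. by case=> n [m [_ m0 _ lb _]]; apply: hiter_gt0_dom m0 lb. Qed.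

(* Either component is empty when it does not apply: labels are of the form
   [(Lab l, set0)], points strictly inside the segment leaving [a] are
   [(set0, Lab a)], and [Rem] is [(set0, set0)]. *)
Definition cell l : set (term q) * set (term q) :=
  (Lab s h l,
   [set t | exists a b, [/\ Edge q s h (a, b), Btw q s h a b l & denotes s h t a]]).

Lemma Lab_eq0 l : ~ Labels q s h l -> Lab s h l = set0 :> set (term q).
Proof. by move=> nL; apply/seteqP; split=> // t tl; case: nL; exists t. Qed.

Lemma cell_Labels l : Labels q s h l -> cell l = (Lab s h l, set0).
Proof.
move=> Ll; congr pair; apply/seteqP; split=> // t [a [b [_ /Btw_not_Labels]]].
by [].
Qed.

Lemma cell_Btw a b l : Edge q s h (a, b) -> Btw q s h a b l ->
  cell l = (set0, Lab s h a).
Proof.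
move=> Eab Bl; congr pair; first by apply: Lab_eq0; apply: Btw_not_Labels Bl.
apply/seteqP; split=> t; last by move=> ta; exists a, b.
by move=> [a' [b' [Ea'b' Bl' ta']]]; rewrite (Btw_source Eab Ea'b' Bl Bl').
Qed.

(** A term of the nonempty set [Lab a] determines the source of the segment, and the source
    determines its target. *)
Lemma cell_eq_Btw a b l : Edge q s h (a, b) ->
  cell l = (set0, Lab s h a) -> Btw q s h a b l.
Proof.
move=> Eab; have [[t ta] _ _] := Eab; case=> _ ela.
have : Lab s h a t by [].
rewrite -ela => -[a' [b' [Ea'b' Bl' ta']]].
have aa' := denotes_functional ta ta'; rewrite -aa' in Ea'b' Bl'.
by rewrite (Edge_target Eab Ea'b').
Qed.

Lemma cell_eq_Labels l l' : Labels q s h l ->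
  (cell l').1 = Lab s h l -> l' = l.
Proof. by move=> Ll /esym/(Lab_inj Ll). Qed.

(** The domain hypothesis matters: an unlabelled location outside the heap also has cell
    [(set0, set0)]. *)
Lemma cell_Rem l : l \in domf h -> Rem q s h l <-> cell l = (set0, set0).
Proof.
move=> lh; split=> [[_ nl]|[L0 B0]].
  have nL : ~ Labels q s h l by move=> Ll; apply: nl; left.
  congr pair; first exact: Lab_eq0.
  apply/seteqP; split=> // t [a [b [Eab Bl _]]]; apply: nl; right.
  by exists (a, b).
split=> // -[[[t tl] _]|[[a b] /= Eab Bl]].
  by have : Lab s h l t by []; rewrite L0.
have [[t ta] _ _] := Eab.
by have : set0 t by rewrite -B0; exists a, b.
Qed.

Lemma Rem_dom l : Rem q s h l -> l \in domf h.
Proof. by case. Qed.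

(** The edge stops at the first label met after [a]. Its interior points are visited before step
    [m], so a subheap containing the path contains the segment. *)
Lemma first_edge n a b : 0 < n -> Labels q s h a -> Labels q s h b ->
  hiter h n a = Some b ->
  exists m c, [/\ 0 < m <= n, hiter h m a = Some c, Edge q s h (a, c)
    & forall l, Btw q s h a c l -> exists2 m', m' < m & hiter h m' a = Some l].
Proof.
move=> n0 La Lb ab.
pose Q m := (0 < m) && `[< exists2 c, hiter h m a = Some c & Labels q s h c >].
have exQ : exists m, Q m.
  by exists n; rewrite /Q n0; apply/asboolP; exists b.
case: (ex_minnP exQ) => m /andP[m0 /asboolP[c ac Lc]] minm.
have free m' v : 0 < m' < m -> hiter h m' a = Some v -> ~ Labels q s h v.
  move=> /andP[m'0 m'm] av Lv; have : m <= m'; last by rewrite leqNgt m'm.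
  by apply: minm; rewrite /Q m'0; apply/asboolP; exists v.
exists m, c; split=> //.
- by rewrite m0 minm // /Q n0; apply/asboolP; exists b.
- by split=> //; exists m.
- move=> l [p [_ [p0 _ al _ af]]]; exists p => //; rewrite ltnNge.
  by apply/negP => mp; apply: (af m c) => //; rewrite m0.
Qed.

Lemma points_to_Edge a b : Labels q s h a -> Labels q s h b ->
  (h.[? a])%fmap = Some b <-> Edge q s h (a, b) /\ Btw q s h a b = set0.
Proof.
move=> La Lb; split=> [ab|[[/= _ _ [n [n0 ab free]]] B0]].
  split; first by split=> //; exists 1; split=> // n v; lia.
  apply/seteqP; split=> // l [n [m [n0 _ _ _ af]]].
  by case: (af 1 b) => //; rewrite n0.
(* An edge of length at least 2 would have the successor of [a] in its [Btw]. *)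
case: n n0 ab free => // -[|n] _ ab free //.
have [r ar rb] := @hiter_split _ h 1 n.+1 _ _ ab.
have : set0 r; last by [].
rewrite -B0; exists 1, n.+1; split=> // m v m1.
by apply: free; lia.
Qed.

End SupportGraphFacts.

(** * Comparison of two sets cell by cell, and splitting *)

Section Blocks.
Variables (LOC : choiceType) (C : Type).
Implicit Types (cell : LOC -> C) (D : {fset LOC}).

Definition block cell D c : {fset LOC} := [fset l in D | `[< cell l = c >]]%fset.

Lemma in_block cell D c l :
  (l \in block cell D c) = (l \in D) && `[< cell l = c >].
Proof. by rewrite !inE. Qed.

Lemma in_blockP cell D c l : l \in block cell D c <-> l \in D /\ cell l = c.
Proof.
by rewrite in_block; split=> [/andP[-> /asboolP]|[-> /asboolP]].
Qed.

Lemma leq_card_fsetP (A : {fset LOC}) n : n <= #|` A| <-> `I_n #<= [set` A].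
Proof.
have /finite_setP[m Am] := finite_fset A.
have := card_fset_set Am; rewrite set_fsetK => ->.
by rewrite (card_le_eqr Am) card_le_II.
Qed.

Lemma exists_subfset_card (A : {fset LOC}) n : n <= #|` A| ->
  exists2 B : {fset LOC}, (B `<=` A)%fset & #|` B| = n.
Proof.
move=> nA; exists [fset x in take n A]%fset.
  by apply/fsubsetP => x; rewrite inE => /mem_take.
by rewrite card_fseq undup_id ?size_takel // take_uniq.
Qed.

(** Counting up to [alpha] cannot tell whether a longer segment lies entirely in [D], which decides
    whether a path can cross it. *)
Definition full cell D0 D c : Prop :=
  forall l, l \in D0 -> cell l = c -> l \in D.

Definition similar alpha cell D0 D cell' D0' D' : Prop := forall c,
  minn alpha #|` block cell D c| = minn alpha #|` block cell' D' c| /\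
  (full cell D0 D c <-> full cell' D0' D' c).

Variables (cell cell' : LOC -> C) (D0 D0' : {fset LOC}).
Let sim alpha D D' := similar alpha cell D0 D cell' D0' D'.

Lemma similar_sym alpha D D' :
  sim alpha D D' -> similar alpha cell' D0' D' cell D0 D.
Proof. by move=> DD' c; have [-> fc] := DD' c; rewrite fc. Qed.

Lemma similar_leq alpha beta D D' :
  beta <= alpha -> sim alpha D D' -> sim beta D D'.
Proof. by move=> ba DD' c; have [cc fc] := DD' c; split=> //; lia. Qed.

Lemma similar_mem alpha D D' l : 0 < alpha -> sim alpha D D' -> l \in D ->
  exists2 l', l' \in D' & cell' l' = cell l.
Proof.
move=> a0 DD' lD; have [cc _] := DD' (cell l).
have : 0 < #|` block cell D (cell l)|.
  by rewrite cardfs_gt0; apply/fset0Pn; exists l; apply/in_blockP.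
move=> n0; have : 0 < #|` block cell' D' (cell l)| by lia.
by rewrite cardfs_gt0 => /fset0Pn[l' /in_blockP[]]; exists l'.
Qed.

(** Fullness of a part is thus expressed by fullness of the union and by a count being zero, which a
    truncated count detects once its bound is positive. *)
Lemma full_fsetUl (f : LOC -> C) (E0 E1 E2 : {fset LOC}) c :
  (E1 `|` E2 `<=` E0)%fset -> fdisjoint E1 E2 ->
  full f E0 E1 c <-> full f E0 (E1 `|` E2)%fset c /\ #|` block f E2 c| = 0.
Proof.
move=> sub dis; split.
  move=> full1; split=> [l lE0 lc|]; first by rewrite inE full1.
  apply/eqP; rewrite cardfs_eq0; apply/negPn/negP => /fset0Pn[l /in_blockP[l2 lc]].
  have lE0 : l \in E0 by apply: (fsubsetP sub); rewrite inE l2 orbT.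
  by have := fdisjointP dis l (full1 l lE0 lc); rewrite l2.
move=> [fullU /cardfs0_eq B0] l lE0 lc.
have := fullU l lE0 lc; rewrite inE => /orP[//|l2].
have : l \in block f E2 c by apply/in_blockP.
by rewrite B0 inE.
Qed.

Lemma minn_split a1 a2 n1 n2 n' : minn (a1 + a2) (n1 + n2) = minn (a1 + a2) n' ->
  exists2 n1', n1' <= n' & minn a1 n1 = minn a1 n1' /\ minn a2 n2 = minn a2 (n' - n1').
Proof.
(* A count not above its bound is copied exactly and the other part takes the rest; if both counts
   exceed their bounds, [a1] points suffice for the first part. *)
move=> e; have [le1|lt1] := leqP n1 a1; last first.
  by have [le2|lt2] := leqP n2 a2; [exists (n' - n2)|exists a1]; lia.
by exists n1; lia.
Qed.

(** In each cell [minn_split] says how many points go to [D1']. Positivity of [a1] and [a2] makes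
    emptiness visible, hence also fullness of the two parts through [full_fsetUl]. *)
Lemma similar_split a1 a2 D1 D2 D' : 0 < a1 -> 0 < a2 ->
  (D1 `|` D2 `<=` D0)%fset -> (D' `<=` D0')%fset -> fdisjoint D1 D2 ->
  sim (a1 + a2) (D1 `|` D2)%fset D' ->
  exists D1' D2', [/\ D' = (D1' `|` D2')%fset, fdisjoint D1' D2',
    sim a1 D1 D1' & sim a2 D2 D2'].
Proof.
move=> a10 a20 sub sub' dis DD'.
have cardU c : #|` block cell (D1 `|` D2)%fset c| =
    #|` block cell D1 c| + #|` block cell D2 c|.
  have -> : block cell (D1 `|` D2)%fset c = (block cell D1 c `|` block cell D2 c)%fset.
    by apply/fsetP => l; rewrite in_fsetU !in_block in_fsetU andb_orl.
  rewrite -cardfsUI; set I := (X in _ + #|` X|); suff -> : I = fset0.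
    by rewrite cardfs0 addn0.
  apply/fsetP => l; rewrite in_fsetI !in_block in_fset0; apply/negP => /andP[/andP[l1 _] /andP[l2 _]].
  by have := fdisjointP dis l l1; rewrite l2.
(* [E c] is the share of the cell [c] given to [D1'], chosen for all cells at once. *)
have /choice[E HE] c : exists E, [/\ (E `<=` block cell' D' c)%fset,
    minn a1 #|` block cell D1 c| = minn a1 #|` E| &
    minn a2 #|` block cell D2 c| = minn a2 #|` (block cell' D' c `\` E)%fset| ].
  have [+ _] := DD' c; rewrite cardU => /minn_split[n1' n1n [e1 e2]].
  have [E EB cE] := exists_subfset_card n1n.
  by exists E; split=> //; rewrite ?cE // cardfsDS // cE.
pose D1' := [fset l in D' | l \in E (cell' l)]%fset.
have B1 c : block cell' D1' c = E c.
  have [EB _ _] := HE c; apply/fsetP => l; apply/idP/idP.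
    by case/in_blockP; rewrite !inE => /andP[_ +] <-.
  move=> lE; have /in_blockP[lD' lc] := fsubsetP EB _ lE.
  by apply/in_blockP; rewrite !inE lc lE; split=> //; rewrite lD'.
have B2 c : block cell' (D' `\` D1')%fset c = (block cell' D' c `\` E c)%fset.
  by apply/fsetP => l; rewrite in_fsetD -B1 !in_block in_fsetD; do 2!case: (_ \in _); case: asboolP.
have sub1 : (D1' `<=` D')%fset by apply/fsubsetP => l; rewrite !inE => /andP[].
have eD' : D' = (D1' `|` (D' `\` D1'))%fset.
  by apply/fsetP => l; rewrite inE in_fsetD; have := fsubsetP sub1 l;
    case: (l \in D1') => // ->.
have dis' : fdisjoint D1' (D' `\` D1')%fset.
  by apply/fdisjointP => l l1; rewrite inE l1.
exists D1', (D' `\` D1')%fset; split=> // c; have [_ e1 e2] := HE c;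
  have [_ fc] := DD' c.
  rewrite B1; split=> //; rewrite (full_fsetUl _ _ sub dis) fc.
  rewrite (@full_fsetUl cell' D0' _ _ c _ dis'); last by rewrite -eD'.
  rewrite -eD' B2; split=> -[? ?]; split=> //; lia.
rewrite B2; split=> //; rewrite fsetUC in sub; rewrite fdisjoint_sym in dis.
rewrite (full_fsetUl _ _ sub dis) fsetUC fc.
rewrite fdisjoint_sym in dis'; rewrite (@full_fsetUl cell' D0' _ _ c _ dis'); last by rewrite fsetUC -eD'.
by rewrite fsetUC -eD' B1; split=> -[? ?]; split=> //; lia.
Qed.

End Blocks.

(** * Labels, edges and cells of two states that agree on the tests *)

Definition agree (LOC : choiceType) (q alpha : nat)
    (s : store LOC) (h : heap LOC) (s' : store LOC) (h' : heap LOC) : Prop :=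
  forall tau : test q, Test alpha tau -> test_sat s h tau <-> test_sat s' h' tau.

Lemma agree_sym (LOC : choiceType) q alpha (s : store LOC) h s' h' :
  agree q alpha s h s' h' -> agree q alpha s' h' s h.
Proof. by move=> ag tau Ttau; rewrite ag. Qed.

Section Matching.
Variables (LOC : choiceType) (q alpha : nat).
Variables (s : store LOC) (h : heap LOC) (s' : store LOC) (h' : heap LOC).
Hypotheses (alpha_gt0 : 0 < alpha) (ag : agree q alpha s h s' h').

Local Notation L := (Labels q s h).
Local Notation L' := (Labels q s' h').
Local Notation matched a a' := (@Lab _ q s h a = @Lab _ q s' h' a').

(** [TestEq t t] says that [t] denotes, and the tests [TestEq t u] for all [u] then determine the
    whole set [Lab]. *)
Lemma match_denotes (t : term q) a : denotes s h t a ->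
  exists2 a', denotes s' h' t a' & matched a a'.
Proof.
move=> ta.
have /(ag _)[] // : test_sat s h (TestEq t t) by exists a; split=> //; exists t.
move=> a' [_ ta' _]; exists a' => //; apply/seteqP; split=> u ua.
  have /(ag _)[] // : test_sat s h (TestEq t u) by exists a; split=> //; exists t.
  by move=> b [_ tb]; rewrite (denotes_functional ta' tb).
have /(ag _)[] // : test_sat s' h' (TestEq t u) by exists a'; split=> //; exists t.
by move=> b [_ tb]; rewrite (denotes_functional ta tb).
Qed.

Lemma match_Labels a : L a -> exists2 a', L' a' & matched a a'.
Proof.
by move=> [t /match_denotes[a' ta' aa']]; exists a' => //; exists t.
Qed.

Lemma match_Labels_transfer a a' : L a -> matched a a' -> L' a'.
Proof. by move=> [t ta] aa'; exists t; have : Lab s' h' a' t by rewrite -aa'. Qed.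

Lemma match_denotes_eq (t : term q) a a' b' : denotes s h t a -> matched a a' ->
  denotes s' h' t b' -> b' = a'.
Proof.
move=> ta aa' tb'; apply: denotes_functional tb' _.
by have : Lab s' h' a' t by rewrite -aa'.
Qed.

Lemma match_var (i : 'I_q) : matched (s i) (s' i).
Proof.
by have [a' <-] := @match_denotes (TVar i) _ erefl.
Qed.

Lemma match_dom a a' : L a -> matched a a' -> a \in domf h -> a' \in domf h'.
Proof.
move=> [t ta] aa' ah.
have /(ag _)[] // : test_sat s h (TestAlloc t).
  by exists a; split=> //; split=> //; exists t.
by move=> b' [[_ /= b'h'] /(match_denotes_eq ta aa') <-].
Qed.

Lemma match_points_to a b a' b' : L a -> L b -> matched a a' -> matched b b' ->
  (h.[? a])%fmap = Some b -> (h'.[? a'])%fmap = Some b'.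
Proof.
move=> La Lb aa' bb' ab.
have [La' Lb'] := (match_Labels_transfer La aa', match_Labels_transfer Lb bb').
have [[t ta] [u ub]] := (La, Lb).
have [Eab B0] := (points_to_Edge La Lb).1 ab.
have /(ag _)[] // : test_sat s h (TestPointsTo t u) by exists a, b.
move=> c [d [Ecd /(match_denotes_eq ta aa') ca' /(match_denotes_eq ub bb') db']].
by rewrite ca' db' in Ecd * => B0'; apply/(points_to_Edge La' Lb').
Qed.

Lemma match_Edge_card a b a' b' n : matched a a' -> matched b b' ->
  0 < n <= alpha -> Edge q s h (a, b) -> `I_n #<= Btw q s h a b ->
  Edge q s' h' (a', b') /\ `I_n #<= Btw q s' h' a' b'.
Proof.
move=> aa' bb' na Eab nB; have [[t ta] [u ub] _] := Eab.
have /(ag _)[] // : test_sat s h (TestSees t u n) by exists a, b.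
by move=> c [d [Ecd /(match_denotes_eq ta aa') <- /(match_denotes_eq ub bb') <-]].
Qed.

(** An edge has either an empty segment, recognised by [TestPointsTo], or at least one interior
    point, recognised by [TestSees] with bound 1. *)
Lemma match_Edge a b a' b' : matched a a' -> matched b b' ->
  Edge q s h (a, b) -> Edge q s' h' (a', b').
Proof.
move=> aa' bb' Eab; have [La Lb _] := Eab.
have [B0|/eqP/set0P[l Bl]] := pselect (Btw q s h a b = set0).
  have La' := match_Labels_transfer La aa'.
  have Lb' := match_Labels_transfer Lb bb'.
  apply: (proj1 ((points_to_Edge La' Lb').1 _)).
  by apply: (match_points_to La Lb aa' bb'); apply/(points_to_Edge La Lb).
apply: (proj1 (@match_Edge_card a b a' b' 1 aa' bb' _ Eab _)) => //.
have /card_eqPle[_ le1] := @card_set1 _ l.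
by apply: card_le_trans le1 (subset_card_le _) => _ ->.
Qed.

(** A point [l] of the cell tells its kind: a label, a segment counted by [TestSees], or the
    remainder counted by [TestSizeR]. *)
Lemma match_block_card c n : 0 < n <= alpha ->
  n <= #|` block (cell q s h) (domf h) c| ->
  n <= #|` block (cell q s' h') (domf h') c|.
Proof.
move=> na nc; have /fset0Pn[l /in_blockP[lh lc]] :
  block (cell q s h) (domf h) c != fset0 by rewrite -cardfs_gt0; apply: leq_trans nc; case/andP: na.
have [Ll|nLl] := pselect (L l).
  have [l' Ll' ll'] := match_Labels Ll.
  (* The cell of a label is a singleton, so one matching allocated label is enough. *)
  suff n1 : n <= 1.
    apply: leq_trans n1 _; rewrite cardfs_gt0; apply/fset0Pn; exists l'.
    apply/in_blockP; split; first exact: match_dom ll' lh.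
    by rewrite -lc !cell_Labels // ll'.
  apply: leq_trans nc _; rewrite -(cardfs1 l) fsubset_leq_card //.
  apply/fsubsetP => m /in_blockP[_ mc]; rewrite inE; apply/eqP.
  by apply: (cell_eq_Labels Ll); rewrite mc -lc.
have [[a [b [Eab Bl]]]|nB] := pselect (exists a b, Edge q s h (a, b) /\ Btw q s h a b l).
  have [La Lb _] := Eab.
  have [[a' La' aa'] [b' Lb' bb']] := (match_Labels La, match_Labels Lb).
  have ec := cell_Btw Eab Bl; rewrite lc in ec.
  have nB : `I_n #<= Btw q s h a b.
    apply: card_le_trans ((leq_card_fsetP _ _).1 nc) (subset_card_le _).
    by move=> m /= /in_blockP[_ mc]; apply: cell_eq_Btw => //; rewrite mc.
  have [Eab' nB'] := match_Edge_card aa' bb' na Eab nB.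
  apply/leq_card_fsetP; apply: card_le_trans nB' (subset_card_le _) => m Bm /=.
  by apply/in_blockP; rewrite (Btw_dom Bm) (cell_Btw Eab' Bm) ec aa'.
have c0 : c = (set0, set0).
  rewrite -lc; apply/cell_Rem => //; split=> // -[[]//|[[a b] Eab Bl]].
  by apply: nB; exists a, b.
have nR : test_sat s' h' (TestSizeR q n).
  apply/ag => //.
  apply: card_le_trans ((leq_card_fsetP _ _).1 nc) (subset_card_le _).
  by move=> m /= /in_blockP[mh]; rewrite c0 => /cell_Rem; apply.
apply/leq_card_fsetP; apply: card_le_trans nR (subset_card_le _) => m Rm /=.
by apply/in_blockP; have mh := Rem_dom Rm; rewrite c0; split=> //; apply/cell_Rem.
Qed.

(** * Transfer of the atoms to subheaps *)

Section SubHeaps.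
Variables D D' : {fset LOC}.
Hypothesis DD' :
  similar alpha (cell q s h) (domf h) D (cell q s' h') (domf h') D'.

Lemma similar_Labels a a' : L a -> matched a a' -> a \in D -> a' \in D'.
Proof.
move=> La aa' aD; have La' := match_Labels_transfer La aa'.
have [l' l'D'] := similar_mem alpha_gt0 DD' aD.
rewrite (cell_Labels La) => el'.
suff <- : l' = a' by [].
by apply: (cell_eq_Labels La'); rewrite el'.
Qed.

Lemma similar_fset0 : D = fset0 -> D' = fset0.
Proof.
move=> D0; apply/eqP; apply/negPn/negP => /fset0Pn[l' l'D'].
by have [l] := similar_mem alpha_gt0 (similar_sym DD') l'D'; rewrite D0.
Qed.

Lemma similar_points_to (i j : 'I_q) :
  ((h.[& D]).[? s i])%fmap = Some (s j) ->
  ((h'.[& D']).[? s' i])%fmap = Some (s' j).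
Proof.
rewrite !fnd_restrict; case: ifP => // iD ij.
rewrite (similar_Labels (Labels_var _ _ _) (match_var i) iD).
by apply: match_points_to ij; rewrite ?match_var //; apply: Labels_var.
Qed.

(** The path in [h'] leaves [a'], which is in [D'] because its cell meets [D], and then the points
    of the segment, which are in [D'] by fullness of the cell [(set0, Lab a)]. *)
Lemma similar_edge a c a' c' : matched a a' -> matched c c' ->
  Edge q s h (a, c) -> a \in D -> (forall l, Btw q s h a c l -> l \in D) ->
  exists2 n, 0 < n & hiter (h'.[& D'])%fmap n a' = Some c'.
Proof.
move=> aa' cc' Eac aD BD; have [La Lc _] := Eac.
have Eac' := match_Edge aa' cc' Eac; have [/= La' _ [n [n0 ac' free]]] := Eac'.
exists n => //; apply/hiter_restrict; split=> // -[|m] r mn a'r.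
  by case: a'r => <-; apply: similar_Labels aD.
have Br : Btw q s' h' a' c' r.
  have [r' a'r' r'c'] := hiter_le (ltnW mn) ac'.
  move: a'r'; rewrite a'r => -[er]; rewrite -er in r'c'.
  exists m.+1, (n - m.+1); split=> //; first by lia.
  by move=> m' v m'm; apply: free; lia.
have [_ [fullD _]] := DD' (set0, Lab s h a).
apply: fullD (Btw_dom Br) _; last by rewrite (cell_Btw Eac' Br) aa'.
by move=> l _ lc; apply: BD; apply: cell_eq_Btw.
Qed.

(** Strong induction on the length, cutting off the first edge. The lengths [n] and [m] may differ,
    as long segments are compared only up to [alpha]. *)
Lemma similar_reach n a b a' b' : 0 < n -> L a -> L b ->
  matched a a' -> matched b b' -> hiter (h.[& D])%fmap n a = Some b ->
  exists2 m, 0 < m & hiter (h'.[& D'])%fmap m a' = Some b'.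
Proof.
elim/ltn_ind: n a a' => n IH a a' n0 La Lb aa' bb' abD.
have [ab inD] := (hiter_restrict _ _ _ _ _).1 abD.
have [m [c [/andP[m0 mn] ac Eac BD]]] := first_edge n0 La Lb ab.
have [_ /= Lc _] := Eac; have [c' Lc' cc'] := match_Labels Lc.
have [|l Bl|p p0 ac'] := similar_edge aa' cc' Eac.
- exact: (inD 0).
- by have [m' m'm al] := BD l Bl; apply: inD al; apply: leq_trans mn.
have [r acD rb] := hiter_le mn abD.
have [ac2 _] := (hiter_restrict _ _ _ _ _).1 acD.
move: ac2 rb; rewrite ac => -[<-] cb.
(* If nothing remains after the edge, then [c = b], and [c'] and [b'] coincide since they carry the
   same terms. *)
have [nm|nm] := posnP (n - m).
  rewrite nm in cb; case: cb => cb; exists p => //; rewrite ac'; congr Some.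
  by apply: (Lab_inj Lc'); rewrite -cc' cb.
have [|k k0 cb'] := IH _ _ c c' nm Lc Lb cc' bb' cb; first by lia.
by exists (p + k); [lia|rewrite (hiter_add _ ac')].
Qed.

End SubHeaps.
End Matching.

(** Fullness is immediate for whole domains. For the counts, [match_block_card] is applied in both
    directions to the truncated cardinals. *)
Lemma agree_similar (LOC : choiceType) q alpha (s : store LOC) h s' h' :
  agree q alpha s h s' h' ->
  similar alpha (cell q s h) (domf h) (domf h)
                (cell q s' h') (domf h') (domf h').
Proof.
move=> ag c; split; last by split=> _ l.
have le1 n := @match_block_card _ _ _ _ _ _ _ ag c n.
have le2 n := @match_block_card _ _ _ _ _ _ _ (agree_sym ag) c n.
set n := #|` _| in le1 le2 *; set n' := #|` _| in le1 le2 *.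
apply/eqP; rewrite eqn_leq; apply/andP; split.
  by have [|] := posnP (minn alpha n); [lia|move=> ?; have := le1 (minn alpha n); lia].
by have [|] := posnP (minn alpha n'); [lia|move=> ?; have := le2 (minn alpha n'); lia].
Qed.

Lemma agree_leq (LOC : choiceType) q alpha beta (s : store LOC) h s' h' :
  beta <= alpha -> agree q alpha s h s' h' -> agree q beta s h s' h'.
Proof.
by move=> ba ag tau Ttau; apply: ag; case: tau Ttau => //= *; lia.
Qed.

(** * Induction on formulas and the characterisation by tests *)

Lemma msize_gt0 phi : 0 < msize phi.
Proof. by elim: phi => //= phi1 IH1 phi2 IH2; lia. Qed.

(** Agreement is kept on the whole heaps at a fixed level [alpha], so the cells do not change during
    the induction; [D], [D'] and the bound [msize phi] do. *)
Lemma similar_sat (LOC : choiceType) q phi alpha (s : store LOC) h s' h' D D' :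
  agree q alpha s h s' h' -> sl_over q phi -> msize phi <= alpha ->
  (D `<=` domf h)%fset -> (D' `<=` domf h')%fset ->
  similar (msize phi) (cell q s h) (domf h) D (cell q s' h') (domf h') D' ->
  sl_sat s (h.[& D])%fmap phi <-> sl_sat s' (h'.[& D'])%fmap phi.
Proof.
move=> ag.
(* The hypotheses are symmetric, so one implication for all pairs suffices; negation uses it with
   the two sides exchanged. *)
wlog suff : s h s' h' D D' ag / sl_over q phi -> msize phi <= alpha ->
  (D `<=` domf h)%fset -> (D' `<=` domf h')%fset ->
  similar (msize phi) (cell q s h) (domf h) D (cell q s' h') (domf h') D' ->
  sl_sat s (h.[& D])%fmap phi -> sl_sat s' (h'.[& D'])%fmap phi.
  move=> oneway ophi ma sD sD' DD'; split; first exact: oneway.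
  by apply: oneway => //; [apply: agree_sym|apply: similar_sym].
elim: phi s h s' h' D D' ag => [x y|x y| |x y|phi IH|phi1 IH1 phi2 IH2|phi1 IH1 phi2 IH2]
  s h s' h' D D' ag /=.
- move=> /andP[xq yq] a0 sD sD' DD' xy.
  have := match_var ag (Ordinal xq); rewrite /= xy => xy'.
  apply: (@Lab_inj _ q _ h'); first exact: (Labels_var _ _ (Ordinal xq)).
  by rewrite -xy' (match_var ag (Ordinal yq)).
- move=> /andP[xq yq] a0 sD sD' DD'.
  exact: (similar_points_to _ (agree_leq a0 ag) DD' (i := Ordinal xq) (j := Ordinal yq)).
- move=> _ a0 sD sD' DD' /(etrans (esym (domf_restrict_sub sD))) D0.
  apply: etrans (domf_restrict_sub sD') _.
  exact: (similar_fset0 _ DD').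
- move=> /andP[xq yq] a0 sD sD' DD' [n n0 xy].
  have [m m0 xy'] := similar_reach (ltn0Sn 0) (agree_leq a0 ag) DD' n0
    (Labels_var s h (Ordinal xq)) (Labels_var s h (Ordinal yq))
    (match_var ag (Ordinal xq)) (match_var ag (Ordinal yq)) xy.
  by exists m.
- move=> ophi ma sD sD' DD' nphi phi'; apply: nphi.
  by apply: IH phi' => //; [apply: agree_sym|apply: similar_sym].
- move=> /andP[o1 o2]; rewrite geq_max => /andP[m1 m2] sD sD' DD' [sat1 sat2].
  split; [apply: IH1 sat1|apply: IH2 sat2] => //; apply: similar_leq DD'; lia.
- move=> /andP[o1 o2] m12 sD sD' DD' [h1 [h2 [dis e sat1 sat2]]].
  have [e1 e2] := catf_restrict dis e.
  have eD : D = (domf h1 `|` domf h2)%fset.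
    by rewrite -domf_cat -e domf_restrict_sub.
  rewrite eD in sD DD'.
  have [D1 [D2 [eD' dis' DD1 DD2]]] :=
    similar_split (msize_gt0 phi1) (msize_gt0 phi2) sD sD' dis DD'.
  rewrite eD' in sD' *; move: sD sD'; rewrite !fsubUset => /andP[s1 s2] /andP[s1' s2'].
  exists (h'.[& D1])%fmap, (h'.[& D2])%fmap; split.
  + by rewrite !domf_restrict_sub.
  + exact: restrict_catf.
  + by rewrite e1 in sat1; apply: IH1 sat1 => //; lia.
  + by rewrite e2 in sat2; apply: IH2 sat2 => //; lia.
Qed.

Theorem theorem4p10 (LOC : choiceType) (q : nat) (phi : sl)
    (phi_over : sl_over q phi) :
  exists psi : boolcomb (test q),
    bc_over (@Test q (msize phi)) psi /\
    forall (s : store LOC) (h : heap LOC),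
      sl_sat s h phi <-> bc_sat (test_sat s h) psi.
Proof.
pose sat (m : store LOC * heap LOC) (tau : test q) := test_sat m.1 m.2 tau.
(* [TestSizeR q 1] contains no term, so it exists even for [q = 0]. *)
have [|//||psi [Ppsi satpsi]] := @bc_of_invariant _ _ (@Test q (msize phi)) sat
    (TestSizeR q 1) (all_tests q (msize phi)) (fun m => sl_sat m.1 m.2 phi).
- by rewrite /= msize_gt0.
- exact: all_tests_over.
- move=> [s h] [s' h'] mm' /=.
  have ag : agree q (msize phi) s h s' h'.
    by move=> tau Ttau; apply: (mm' tau); apply: In_all_tests.
  have := similar_sat ag phi_over (leqnn _) (fsubset_refl _) (fsubset_refl _)
    (agree_similar ag).
  have rid (g : heap LOC) : (g.[& domf g])%fmap = g.
    by apply/fmapP => k; rewrite fnd_restrict; case: ifP => // /negbT/not_fnd.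
  by rewrite !rid => -[].
- by exists psi; split=> // s h; apply: (satpsi (s, h)).
Qed.
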